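(* There exists a function $c(k)=\exp(\mathcal{O}(k^2))$ such that, for every $k\ge1$, there is a randomized online algorithm for the generalized $k$-server problem on weighted uniform metrics which is $c(k)$-competitive, i.e. the problem admits an $\exp(\mathcal{O}(k^2))$-competitive randomized online algorithm.
   Context: Generalized $k$-server on weighted uniform metrics: there are $k$ pairwise disjoint sets $M_1,\dots,M_k$ and non-negative weights $w_1\le\cdots\le w_k$; in each $M_\ell$ distinct points are at distance $w_\ell$. There is one server $s_\ell$ moving in $M_\ell$ for each $\ell$, with a given initial position. Each request is a tuple $r\in M_1\times\cdots\times M_k$ with components $r[1],\dots,r[k]$; requests arrive online, and each must be served, before the next is revealed, by ensuring that for at least one $\ell$ the server $s_\ell$ is located at $r[\ell]$. Each movement of $s_\ell$ to a different point costs $w_\ell$. For a request sequence $\rho$, $\mathrm{OPT}(\rho)$ is the minimum cost of serving $\rho$ in hindsight, and $\mathrm{ALG}(\rho)$ is the expected cost of the randomized online algorithm (against an oblivious adversary). An algorithm is $c$-competitive, where $c$ depends only on $k$, if there is a constant $c'$ not depending on $\rho$ (it may depend on the weights and the initial configuration) such that $\mathrm{ALG}(\rho)\le c\cdot\mathrm{OPT}(\rho)+c'$ for every finite request sequence $\rho$. *)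

(* Defs.v *)
From HB Require Import structures.
From mathcomp Require Import all_boot all_order all_algebra.
From mathcomp Require Import all_classical all_reals all_analysis.

Set Implicit Arguments.
Unset Strict Implicit.
Unset Printing Implicit Defensive.

Import Order.TTheory GRing.Theory Num.Theory.
Import numFieldNormedType.Exports.

Local Open Scope classical_set_scope.
Local Open Scope ring_scope.

(* The sets M_1, ..., M_k are a family of types
   indexed by 'I_k, which makes them pairwise disjoint; they may be infinite. *)

(* Points of M_1 x ... x M_k: server configurations as well as requests. *)
Definition config k (M : 'I_k -> eqType) : Type := forall l : 'I_k, M l.

Section GeneralizedKServer.
Context {R : realType} {k : nat} {M : 'I_k -> eqType}.
Implicit Types (w : 'I_k -> R) (s r : config M) (ss rho : seq (config M)).

Definition serves s r : bool := [exists l, s l == r l].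

Definition wdist w (l : 'I_k) (x y : M l) : R := if x == y then 0 else w l.

Definition move_cost w s s' : R := \sum_(l < k) wdist w (s l) (s' l).

Fixpoint total_cost w s ss : R :=
  if ss is s' :: ss' then move_cost w s s' + total_cost w s' ss' else 0.

(* [ss] lists the configurations at which the successive requests are served;
   [all2] includes the equality of the two lengths. *)
Definition feasible rho ss : bool := all2 serves ss rho.

(* The infimum is a minimum, see [OPT_attained]. *)
Definition OPT w s0 rho : R :=
  inf [set total_cost w s0 ss | ss in [set ss | feasible rho ss]].

(* [alg_pos h] is the configuration once the requests of [h] have been served. *)
Record online_algorithm (s0 : config M) := OnlineAlgorithm {
  alg_pos :> seq (config M) -> config M ;
  alg_pos0 : alg_pos [::] = s0 ;
  alg_serves : forall h r, serves (alg_pos (rcons h r)) r }.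

Definition run s0 (A : online_algorithm s0) rho : seq (config M) :=
  [seq A (take i.+1 rho) | i <- iota 0 (size rho)].

(* A random deterministic online algorithm over an arbitrary probability space.
   The measurability conditions make the cost on every request sequence a
   random variable, see [measurable_run_cost]. *)
Record randomized_algorithm (s0 : config M) := RandomizedAlgorithm {
  ra_display : measure_display ;
  ra_space : measurableType ra_display ;
  ra_prob : probability ra_space R ;
  ra_alg :> ra_space -> online_algorithm s0 ;
  ra_measurable_pos : forall h (l : 'I_k) (x : M l),
    measurable [set o : ra_space | ra_alg o h l = x] ;
  ra_measurable_move : forall h r (l : 'I_k),
    measurable [set o : ra_space | ra_alg o (rcons h r) l = ra_alg o h l] }.

(* The request sequence does not depend on the random outcome [o]: the
   adversary is oblivious. *)
Definition ALG w s0 (A : randomized_algorithm s0) rho : \bar R :=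
  'E_(ra_prob A)[fun o => total_cost w s0 (run (A o) rho)].

Definition competitive w s0 (A : randomized_algorithm s0) (c : R) : Prop :=
  exists c' : R, forall rho, (ALG w A rho <= (c * OPT w s0 rho + c')%:E)%E.

Lemma move_cost_ge0 w s s' : (forall l, 0 <= w l) -> 0 <= move_cost w s s'.
Proof.
by move=> w0; apply: sumr_ge0 => l _; rewrite /wdist; case: ifP.
Qed.

Lemma total_cost_ge0 w s ss : (forall l, 0 <= w l) -> 0 <= total_cost w s ss.
Proof.
move=> w0; elim: ss s => //= s' ss IH s.
by rewrite addr_ge0 ?move_cost_ge0.
Qed.

Lemma total_cost_count w s ss :
  exists c : {ffun 'I_k -> 'I_(size ss).+1},
    total_cost w s ss = \sum_(l < k) w l *+ c l.
Proof.
suff [c cle ->] : exists2 c : 'I_k -> nat, (forall l, (c l <= size ss)%N) &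
    total_cost w s ss = \sum_(l < k) w l *+ c l.
  exists [ffun l => inord (c l)]; apply: eq_bigr => l _.
  by rewrite ffunE inordK // ltnS.
elim: ss s => [|s' ss IH] s /=.
  by exists (fun=> 0%N) => //; rewrite big1.
have [c cle ->] := IH s'.
exists (fun l => (s l != s' l) + c l)%N => [l|].
  by case: eqP => _ /=; rewrite ?add0n ?add1n ?ltnS // (leq_trans (cle l)).
rewrite /move_cost -big_split; apply: eq_bigr => l _ /=.
by rewrite mulrnDr /wdist; case: eqP.
Qed.

Lemma feasible_id rho : (0 < k)%N -> feasible rho rho.
Proof.
move=> k0; elim: rho => //= r rho IH; rewrite /feasible /= -/(feasible _ _) IH.
by rewrite andbT; apply/existsP; exists (Ordinal k0).
Qed.

Lemma OPT_attained w s0 rho : (0 < k)%N ->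
  exists2 ss, feasible rho ss & total_cost w s0 ss = OPT w s0 rho.
Proof.
move=> k0; pose n := size rho.
pose val (c : {ffun 'I_k -> 'I_n.+1}) : R := \sum_(l < k) w l *+ c l.
pose Q c := `[< exists2 ss, feasible rho ss & total_cost w s0 ss = val c >].
have Qof ss : feasible rho ss -> exists2 c, Q c & total_cost w s0 ss = val c.
  move=> fss; have [c cE] := total_cost_count w s0 ss.
  have sz : size ss = n by move: fss; rewrite /feasible all2E => /andP[/eqP].
  move: c cE; rewrite sz => c cE; exists c => //.
  by apply/asboolP; exists ss.
have [c0 Qc0 _] := Qof _ (feasible_id rho k0).
case: (arg_minP val Qc0) => c Qc cmin.
have /asboolP [ss fss ssE] := Qc.
exists ss => //; rewrite /OPT; apply/eqP; rewrite eq_le; apply/andP; split.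
  apply: lb_le_inf; first by exists (total_cost w s0 ss), ss.
  by move=> _ [tt /Qof [c1 Qc1 ->] <-]; rewrite ssE cmin.
apply: ge_inf; last by exists ss.
exists (val c) => _ [tt /Qof [c1 Qc1 ->] <-]; exact: cmin.
Qed.

Lemma run_rcons s0 (A : online_algorithm s0) rho r :
  run A (rcons rho r) = rcons (run A rho) (A (rcons rho r)).
Proof.
rewrite /run size_rcons -addn1 iotaD map_cat /= add0n cats1.
rewrite take_oversize ?size_rcons //; congr rcons.
apply/eq_in_map => i; rewrite mem_iota /= add0n => ilt.
by rewrite -cats1 takel_cat.
Qed.

Lemma last_run s0 (A : online_algorithm s0) rho : last s0 (run A rho) = A rho.
Proof.
case/lastP: rho => [|rho r]; first by rewrite /run /= alg_pos0.
by rewrite run_rcons last_rcons.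
Qed.

Lemma total_cost_rcons w s ss s' :
  total_cost w s (rcons ss s') = total_cost w s ss + move_cost w (last s ss) s'.
Proof.
by elim: ss s => [|t ss IH] s /=; rewrite ?addr0 ?add0r // IH addrA.
Qed.

Lemma measurable_run_cost w s0 (A : randomized_algorithm s0) rho :
  measurable_fun setT (fun o => total_cost w s0 (run (A o) rho)).
Proof.
elim/last_ind: rho => [|rho r IH] /=; first exact: measurable_cst.
under eq_fun do rewrite run_rcons total_cost_rcons last_run.
apply: measurable_realfun.measurable_funD => //; apply: measurable_sum => l.
rewrite /wdist; apply: measurable_fun_ifT => //.
apply: (measurable_fun_bool true); rewrite setTI.
rewrite [X in measurable X](_ : _ =
  [set o | A o (rcons rho r) l = A o rho l]); first exact: ra_measurable_move.
by apply/seteqP; split => o /=; [move/eqP => -> | move=> ->; rewrite eqxx].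
Qed.

Lemma feasible_run s0 (A : online_algorithm s0) rho : feasible rho (run A rho).
Proof.
elim/last_ind: rho => // rho r IH; rewrite run_rcons /feasible all2E.
rewrite !size_rcons eqSS zip_rcons; last by rewrite size_map size_iota.
rewrite all_rcons /= alg_serves /=.
by move: IH; rewrite /feasible all2E.
Qed.

End GeneralizedKServer.

(* Main.v *)
Require Import Defs.
From HB Require Import structures.
From mathcomp Require Import all_boot all_order all_algebra all_fingroup.
From mathcomp Require Import all_classical all_reals all_analysis.
From mathcomp Require Import zify ring lra.

(* Put v_0 = w_1 and v_l = w_l.  A 0-phase is a nonempty request sequence, and
   an (l+1)-phase is one in which, for every point x of M_(l+1), the requests
   avoiding x contain at least 2^j v_(l+1) / v_l disjoint l-phases (j being an
   extra strength parameter).  Serving an l-phase with the l lightest servers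
   costs at least v_l: either server l moves, or it sits at some x all along.

   If a set of at most K points destroys an l-phase of strength j+1, in the
   sense that the requests avoiding it do not contain an l-phase of strength j,
   then it destroys half of some family of (l-1)-phases, so it contains a point
   that is popular in that family; by induction on l, all these sets meet one
   list of doubly exponentially many points.  Hence, once 2^(j+1) v_(l+1) / v_l
   disjoint l-phases of strength j+1 have been seen, there are only doubly
   exponentially many candidate points x at which server l+1 could stay.

   Within an (l+1)-phase the algorithm first ignores server l+1 until this
   happens, then keeps server l+1 at the first live candidate in a random order,
   running the algorithm of level l on the requests that avoid it.  With N
   candidates, the expected number of changes is at most the harmonic number
   H_N = 2^O(k), so each level loses a factor 2^O(k).  The random orders are
   reused in all phases: the adversary is oblivious, so only expectations
   matter. *)

Set Implicit Arguments.
Unset Strict Implicit.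
Unset Printing Implicit Defensive.

Import Order.TTheory GRing.Theory Num.Theory.
Import numFieldNormedType.Exports.

Local Open Scope classical_set_scope.
Local Open Scope ring_scope.

(** * Phases and the points that destroy them *)

Section PopularElements.
Local Open Scope nat_scope.
Context {E : eqType}.
Implicit Types (es : seq (seq E)) (X : seq E).

Definition freq es x := count (fun e : seq E => x \in e) es.

Lemma sum_nat_const_seq (I : Type) (s : seq I) n :
  \sum_(i <- s) n = size s * n.
Proof. by rewrite big_const_seq count_predT iter_addn_0 mulnC. Qed.

Lemma sum_freq_le es P : uniq P ->
  \sum_(x <- P) freq es x <= \sum_(e <- es) size e.
Proof.
move=> uP; rewrite /freq; under eq_bigr do rewrite -sum1_count big_mkcond.
rewrite exchange_big leq_sum // => e _.
rewrite -big_mkcond sum1_count -size_filter.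
apply: uniq_leq_size; first exact: filter_uniq.
by move=> x; rewrite mem_filter => /andP[].
Qed.

Lemma count_has_le es X :
  count (fun e => has (mem e) X) es <= \sum_(x <- X) freq es x.
Proof.
rewrite /freq; under [X in _ <= X]eq_bigr do rewrite -sum1_count big_mkcond.
rewrite exchange_big -sum1_count big_mkcond leq_sum // => e _.
rewrite -big_mkcond sum1_count has_count; case: ltnP => //.
Qed.

(** Double counting. The frequencies add up to at most [n.*2 * N], so at most [K.*2 * N] elements
    have [n < K * freq es x]. If [X] contains none of these, each of its at most [K] points lies in
    at most [n / K] sets, so that [X] meets at most [n] of them. *)
Lemma popular_elements es N K n : 0 < n ->
  size es = n.*2 -> all (fun e => size e <= N) es ->
  exists2 P : seq E, size P <= K.*2 * N &
    forall X, size X <= K -> n < count (fun e => has (mem e) X) es ->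
      has (mem P) X.
Proof.
move=> n0 ses aes.
exists [seq x <- undup (flatten es) | n < K * freq es x].
  have : n * size [seq x <- undup (flatten es) | n < K * freq es x] <=
      K * (n.*2 * N).
    apply: (@leq_trans (K * \sum_(e <- es) size e)); last first.
      rewrite leq_mul2l; apply/orP; right.
      rewrite -ses; elim: es aes {ses} => [|e es IH]; first by rewrite big_nil.
      by move=> /= /andP[se /IH]; rewrite big_cons mulSn; apply: leq_add.
    set P := [seq _ <- _ | _].
    apply: (@leq_trans (K * \sum_(x <- P) freq es x)); last first.
      by rewrite leq_mul2l sum_freq_le ?orbT // filter_uniq ?undup_uniq.
    rewrite mulnC -sum_nat_const_seq big_distrr /= !big_seq.
    by apply: leq_sum => x; rewrite mem_filter => /andP[/ltnW].
  by rewrite -!muln2 -mulnA mulnCA leq_mul2l gtn_eqF //= -mulnA.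
move=> X sX nX; apply/negPn/negP => /hasPn noX.
suff : K * count (fun e => has (mem e) X) es <= K * n.
  case: K sX {noX} => [|K] sX; last by rewrite leq_mul2l /= leqNgt nX.
  by move: nX; case: X sX => //=; rewrite count_pred0.
apply: leq_trans (leq_mul (leqnn K) (count_has_le es X)) _.
apply: (@leq_trans (size X * n)); last by rewrite leq_mul2r sX orbT.
rewrite -sum_nat_const_seq big_distrr /= !big_seq; apply: leq_sum => x xX.
have := noX x xX; rewrite /= mem_filter mem_undup negb_and -leqNgt.
case/orP => // xes; rewrite (_ : freq es x = 0) ?muln0 //.
apply/eqP; rewrite -leqn0 leqNgt -has_count; apply: contra xes.
by case/hasP => e ees xe; apply/flattenP; exists e.
Qed.

End PopularElements.

(** * Nested phases and hitting sets for their killers *)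

Section Phases.
Local Open Scope nat_scope.

(** At level 0 these are the [k] components of one request. Above, [u] bounds a hitting set for a
    family of phases one level down, against [K.+1] points; [u * u] allows one more such set for
    each of its elements. *)
Fixpoint killer_bound (k l K : nat) : nat :=
  if l is l'.+1 then
    let u := K.+1.*2 * killer_bound k l' K.+1 in u + u * u
  else k.

Context {k : nat} {M : 'I_k -> eqType}.
Implicit Types (h : seq (config M)) (P : seq (config M) -> Prop).

Definition point : Type := {l : 'I_k & M l}.
HB.instance Definition _ := Equality.on point.
Implicit Types (x : point) (X : seq point) (r : config M).

Definition hits x r : bool := r (tag x) == tagged x.

(* Histories are in reverse chronological order, most recent request first. *)
Definition avoid X h := [seq r <- h | ~~ has (hits^~ r) X].

Lemma avoid_cat X h1 h2 : avoid X (h1 ++ h2) = avoid X h1 ++ avoid X h2.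
Proof. exact: filter_cat. Qed.

Lemma avoid_avoid X Y h : avoid X (avoid Y h) = avoid (X ++ Y) h.
Proof.
rewrite /avoid -filter_predI; apply: eq_filter => r /=.
by rewrite has_cat negb_or.
Qed.

Lemma avoidC X Y h : avoid X (avoid Y h) = avoid Y (avoid X h).
Proof. by rewrite /avoid -!filter_predI; apply: eq_filter => r /=; rewrite andbC. Qed.

Fixpoint many P n h : Prop :=
  if n is n'.+1 then
    exists h0 h1 h2, [/\ h = h0 ++ h1 ++ h2, P h1 & many P n' h2]
  else True.

Lemma many_catl P n h0 h : many P n h -> many P n (h0 ++ h).
Proof.
case: n => //= n [g0 [g1 [g2 [-> P1 P2]]]].
by exists (h0 ++ g0), g1, g2; rewrite catA.
Qed.

Lemma many_catr P n h h0 : many P n h -> many P n (h ++ h0).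
Proof.
elim: n h => //= n IH h [g0 [g1 [g2 [-> P1 P2]]]].
by exists g0, g1, (g2 ++ h0); rewrite !catA; split=> //; apply: IH.
Qed.

Lemma many_le P n n' h : n' <= n -> many P n h -> many P n' h.
Proof.
elim: n n' h => [|n IH] [|n'] h //= ltn [g0 [g1 [g2 [-> P1 P2]]]].
by exists g0, g1, g2; split=> //; apply: IH.
Qed.

Lemma filter_split (T : Type) (a : pred T) (s s1 s2 : seq T) :
  seq.filter a s = s1 ++ s2 ->
  exists t1 t2, [/\ s = t1 ++ t2, seq.filter a t1 = s1 & seq.filter a t2 = s2].
Proof.
elim: s s1 => [|x s IH] s1 /=; first by case: s1 => //= <-; exists [::], [::].
case: ifP => ax.
  case: s1 => [/= <-|y s1 /= [<- /IH [t1 [t2 [-> <- <-]]]]].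
    by exists [::], (x :: s); rewrite /= ax.
  by exists (x :: t1), t2; rewrite /= ax.
by move=> /IH [t1 [t2 [-> <- <-]]]; exists (x :: t1), t2; rewrite /= ax.
Qed.

Lemma many_avoid P X n h : (forall g, P (avoid X g) -> P g) ->
  many P n (avoid X h) -> many P n h.
Proof.
move=> PX; elim: n h => //= n IH h [g0 [g1 [g2 [hE P1 P2]]]].
have [t0 [t' [-> _ /filter_split [t1 [t2 [-> t1E t2E]]]]]] := filter_split hE.
exists t0, t1, t2; split=> //; first by apply: PX; rewrite /avoid t1E.
by apply: IH; rewrite /avoid t2E.
Qed.

Context (m : nat -> nat).

Fixpoint phase l j h : Prop :=
  if l is l'.+1 then forall x : point, tag x = l' :> nat ->
    many (phase l' j) (2 ^ j * m l') (avoid [:: x] h)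
  else h <> [::].

Lemma phase_cat l j h0 h h1 : phase l j h -> phase l j (h0 ++ h ++ h1).
Proof.
case: l => [|l] /=; first by case: h0 h => [|? ?] [].
by move=> ph x /ph; rewrite !avoid_cat => ?; apply/many_catl/many_catr.
Qed.

Lemma phase_cons l j r h : phase l j h -> phase l j (r :: h).
Proof. by move/(phase_cat [:: r] [::]); rewrite cats0. Qed.

Lemma phase_avoid l j X h : phase l j (avoid X h) -> phase l j h.
Proof.
elim: l X h => [|l IH] X h /=; first by case: h.
by move=> ph x /ph; rewrite avoidC; apply: many_avoid => g; apply: IH.
Qed.

Context (m_gt0 : forall l, 0 < m l).

Lemma mult_gt0 j l : 0 < 2 ^ j * m l.
Proof. by rewrite muln_gt0 expn_gt0 m_gt0. Qed.

Lemma many_nil P n : 0 < n -> many P n [::] -> P [::].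
Proof. by case: n => //= n _ [[|? ?] [[|? ?] [g2 []]]]. Qed.

(** Over an empty set the quantifier in [phase] would be vacuous; [s0] provides a point at each
    level. *)
Lemma phase_nil (s0 : config M) l j : l <= k -> ~ phase l j [::].
Proof.
elim: l => [|l IH] lk //= /(_ (Tagged M (s0 (Ordinal lk))) erefl).
by move=> /(many_nil (mult_gt0 j l)); apply: IH; apply: ltnW.
Qed.

(* [E] is a hitting set for the sets of at most [K] points whose avoidance
   turns [P] into the failure of [P']. *)
Definition has_killers P P' N K := forall h, P h ->
  exists2 E : seq point, size E <= N &
    forall X, size X <= K -> ~ P' (avoid X h) -> has (mem E) X.

(** If fewer than [n] of the [n.*2] blocks survive the removal of [X], then [X] meets more than [n]
    of their hitting sets, hence contains a popular element. *)
Lemma many_killers P P' N K n : 0 < n -> has_killers P P' N K ->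
  has_killers (many P n.*2) (many P' n) (K.*2 * N) K.
Proof.
move=> n0 PP' h Ph.
have [es [ses aes esP]] : exists es : seq (seq point), [/\ size es = n.*2,
    all (fun e => size e <= N) es &
    forall X, size X <= K ->
      many P' (count (fun e => ~~ has (mem e) X) es) (avoid X h)].
  elim: {n n0}n.*2 h Ph => [|n IH] h /=; first by exists [::].
  move=> [g0 [g1 [g2 [-> /PP' [E sE EP]]]]] /IH [es [ses aes esP]].
  exists (E :: es); split=> /=; [by rewrite ses|by rewrite sE|move=> X sX].
  rewrite !avoid_cat; case: (boolP (has _ X)) => hE /=; rewrite ?add0n ?add1n.
    by do 2!apply: many_catl; apply: esP.
  exists (avoid X g0), (avoid X g1), (avoid X g2); split=> //; last exact: esP.
  by apply: contrapT => /(EP X sX); apply/negP.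
have [Q sQ QP] := popular_elements K n0 ses aes.
exists Q => // X sX nX; apply: QP => //.
have : ~~ (n <= count (fun e => ~~ has (mem e) X) es).
  by apply/negP => le; apply: nX; apply: many_le le _; apply: esP.
have := count_predC (fun e => has (mem e) X) es; rewrite ses.
rewrite (@eq_count _ (predC _) (fun e => ~~ has (mem e) X)) // -ltnNge.
by move: (count _ es) (count _ es) => a b; lia.
Qed.

Lemma phase_killers (s0 : config M) l j K : l <= k ->
  has_killers (phase l j.+1) (phase l j) (killer_bound k l K) K.
Proof.
elim: l K => [|l IH] K lk h.
  case: h => //= r h _; exists [seq Tagged M (r i) | i <- enum 'I_k].
    by rewrite size_map size_enum_ord.
  move=> X _ nX; apply: contrapT => hX; apply: nX; rewrite /= /avoid /=.
  suff -> : ~~ has (hits^~ r) X by [].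
  apply/negP => /hasP[[i y] yX /eqP /= rE]; apply: hX; apply/hasP.
  exists (Tagged M y) => //=; rewrite -rE.
  by apply/mapP; exists i; rewrite ?mem_enum.
have step : has_killers (many (phase l j.+1) (2 ^ j.+1 * m l))
    (many (phase l j) (2 ^ j * m l)) (K.+1.*2 * killer_bound k l K.+1) K.+1.
  rewrite expnS -mulnA mul2n; apply: many_killers; first exact: mult_gt0.
  exact/IH/ltnW.
rewrite /= -/(killer_bound _ _ _); set u := K.+1.*2 * killer_bound k l K.+1 in step *.
(* The family is present in [h] itself, since it is present in the requests avoiding a point taken
   from [s0]. *)
move=> ph; have [|E sE EP] := step h.
  pose x := Tagged M (s0 (Ordinal lk)).
  apply: (@many_avoid _ [:: x]); last exact: ph.
  by move=> g; apply: phase_avoid.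
pose F x := if pselect (many (phase l j.+1) (2 ^ j.+1 * m l) (avoid [:: x] h))
  is left H then s2val (cid2 (step _ H)) else [::].
have sF x : size (F x) <= u.
  by rewrite /F; case: pselect => // H; case: (cid2 _).
exists (E ++ flatten [seq F x | x <- E]).
  rewrite size_cat leq_add // size_flatten.
  apply: (@leq_trans (size E * u)); last by rewrite leq_mul2r sE orbT.
  elim: (E) => //= x E' IHE; rewrite mulSn leq_add //.
(* The phase fails because of some point [q], so [q :: X] destroys the family in [h]: either [X]
   meets [E], or [q] lies in [E]. In the latter case [X] meets [F q], the hitting set for the
   requests avoiding [q]. *)
move=> X sX /existsNP [q /not_implyP [tq nq]].
rewrite avoid_avoid /= in nq.
have /= := EP (q :: X) sX nq.
case/orP => [qE|/hasP[x xX xE]]; last first.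
  by apply/hasP; exists x => //; rewrite /= mem_cat; apply/orP; left.
have [x xX xF] : exists2 x, x \in X & x \in F q.
  rewrite /F; case: pselect => [H|[]]; last exact: ph.
  case: (cid2 _) => /= E' sE' E'P; apply/hasP; apply: E'P.
    exact: leq_trans sX _.
  by rewrite avoid_avoid; move: nq; rewrite -[q :: X]cat1s -!avoid_avoid avoidC.
apply/hasP; exists x => //=; rewrite mem_cat; apply/orP; right.
by apply/flattenP; exists (F q) => //; apply: map_f.
Qed.

End Phases.

Arguments avoid : simpl never.

(** * Random orders *)

Section Average.
Context {R : realType}.
Implicit Types T : finType.

Definition avg T (f : T -> R) : R := (\sum_t f t) / #|T|%:R.

Lemma avgD T (f g : T -> R) : avg (fun t => f t + g t) = avg f + avg g.
Proof. by rewrite /avg big_split mulrDl. Qed.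

Lemma avgZ T c (f : T -> R) : avg (fun t => c * f t) = c * avg f.
Proof. by rewrite /avg -big_distrr mulrA. Qed.

Lemma avg_sum T (I : finType) (A : pred I) (f : I -> T -> R) :
  avg (fun t => \sum_(i in A) f i t) = \sum_(i in A) avg (f i).
Proof. by rewrite /avg exchange_big big_distrl. Qed.

Lemma eq_avg T (f g : T -> R) : f =1 g -> avg f = avg g.
Proof. by move=> fg; rewrite /avg (eq_bigr g). Qed.

Lemma avg_le T (f g : T -> R) : (forall t, f t <= g t) -> avg f <= avg g.
Proof.
move=> fg; rewrite /avg ler_wpM2r ?invr_ge0 ?ler0n //.
by apply: ler_sum => t _; apply: fg.
Qed.

Lemma avg_cst T c : (0 < #|T|)%N -> avg (fun _ : T => c) = c.
Proof.
move=> T0; rewrite /avg sumr_const -[c *+ _]mulr_natr mulfK //.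
by rewrite pnatr_eq0 -lt0n.
Qed.

Lemma avg_ge0 T (f : T -> R) : (forall t, 0 <= f t) -> 0 <= avg f.
Proof. by move=> f0; rewrite divr_ge0 ?sumr_ge0. Qed.

Lemma avg_pair (T1 T2 : finType) (f : T1 * T2 -> R) :
  avg f = avg (fun t1 => avg (fun t2 => f (t1, t2))).
Proof.
have -> : avg f = (\sum_t1 \sum_t2 f (t1, t2)) / #|{: T1 * T2}|%:R.
  by rewrite pair_bigA; congr (_ / _); apply: eq_bigr => -[].
by rewrite /avg card_prod natrM -big_distrl /= invfM mulrA mulrAC.
Qed.

Definition harm n : R := \sum_(i < n) i.+1%:R^-1.

Lemma harmS n : harm n.+1 = harm n + n.+1%:R^-1.
Proof. by rewrite /harm big_ord_recr. Qed.

Lemma harm_ge0 n : 0 <= harm n.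
Proof. by apply: sumr_ge0. Qed.

Lemma ler_harm m n : (m <= n)%N -> harm m <= harm n.
Proof.
elim: n => [|n IH]; first by rewrite leqn0 => /eqP ->.
rewrite leq_eqVlt => /orP[/eqP -> //|/IH /le_trans -> //].
by rewrite harmS lerDl invr_ge0.
Qed.

Lemma harm_sub m n : (m <= n)%N ->
  (n - m)%:R / n%:R <= harm n - harm m.
Proof.
move=> mn; suff sub d : (m + d <= n)%N -> d%:R / n%:R <= harm (m + d) - harm m.
  by rewrite -[X in harm X - _](subnKC mn) sub ?subnKC.
elim: d => [|d IH] dn; first by rewrite mul0r addn0 subrr.
rewrite addnS harmS addrAC -natr1 mulrDl mul1r lerD ?IH //.
  by apply: leq_trans dn; rewrite addnS.
by rewrite lef_pV2 ?posrE ?ltr0n // ?ler_nat -?addnS // (leq_trans _ dn) ?addnS.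
Qed.

(** Dyadic blocks: doubling the number of terms adds at most 1. *)
Lemma harm_exp2 n : harm (2 ^ n) <= n.+1%:R.
Proof.
elim: n => [|n IH]; first by rewrite expn0 /harm big_ord1 invr1.
rewrite -natr1 -lerBlDr (le_trans _ IH) //.
suff dbl d m : (d <= m)%N -> harm (m + d) - d%:R / m.+1%:R <= harm m.
  rewrite (le_trans _ (dbl (2 ^ n)%N _ (leqnn _))) // expnS mul2n -addnn.
  rewrite lerB // ler_pdivrMr ?ltr0n // mul1r ler_nat leqW //.
move=> _; elim: d => [|d IHd]; first by rewrite addn0 mul0r subr0.
rewrite addnS harmS -[d.+1%:R]natr1 mulrDl mul1r opprD addrACA -[leRHS]addr0 lerD //.
by rewrite subr_le0 lef_pV2 ?posrE ?ltr0n // ler_nat ltnS leq_addr.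
Qed.

Section RandomOrder.
Context {N : nat}.
Implicit Types (s : {perm 'I_N}) (A : {set 'I_N}).

Lemma card_perm_gt0 : (0 < #|{perm 'I_N}|)%N.
Proof. by apply/card_gt0P; exists 1%g. Qed.

Definition first_of s A : option 'I_N :=
  [pick i in A | [forall j in A, (s i <= s j)%N]].

Lemma first_ofP s A i : reflect (i \in A /\ {in A, forall j, (s i <= s j)%N})
  (first_of s A == Some i).
Proof.
rewrite /first_of; case: pickP => [i' /andP[i'A /forall_inP i'le]|no].
  apply: (iffP eqP) => [[<-] //|[iA ile]]; congr Some.
  by apply: (@perm_inj _ s); apply/val_inj/eqP; rewrite eqn_leq i'le ?ile.
constructor=> -[iA ile]; have := no i; rewrite iA /=.
by move/forall_inP; apply.
Qed.

Lemma first_of_some s A : (0 < #|A|)%N -> exists2 i, i \in A & first_of s A = Some i.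
Proof.
case/card_gt0P => i0 i0A; case: (arg_minnP (fun i => s i : nat) i0A) => i iA imin.
by exists i => //; apply/eqP/first_ofP; split.
Qed.

Lemma first_of_mem s A i : first_of s A = Some i -> i \in A.
Proof. by move/eqP/first_ofP => []. Qed.

(** This is why the algorithm changes its candidate only when that candidate dies. *)
Lemma first_of_sub s A (B : {set _}) i :
  B \subset A -> first_of s A = Some i -> i \in B -> first_of s B = Some i.
Proof.
move=> /fintype.subsetP BA /eqP/first_ofP[_ ile] iB; apply/eqP/first_ofP; split=> //.
by move=> j /BA; apply: ile.
Qed.

(** By symmetry: composing with the transposition of [j] and [j'] carries the orders where [j] comes
    first to those where [j'] does, so all elements of [A] come first equally often. *)
Lemma avg_first_of A i : i \in A ->
  avg (fun s => (first_of s A == Some i)%:R) = #|A|%:R^-1.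
Proof.
move=> iA; pose c i := \sum_s (first_of s A == Some i)%:R : R.
have cle j j' : j \in A -> j' \in A -> c j <= c j'.
  move=> jA j'A; rewrite /c.
  rewrite [leRHS](reindex_inj (mulgI (tperm j j'))) /=.
  apply: ler_sum => s _; case: first_ofP => // -[_ jle].
  suff -> : first_of (tperm j j' * s) A == Some j' by [].
  apply/first_ofP; split=> // x xA; rewrite !permM tpermR jle //.
  by case: tpermP.
have cE j : j \in A -> c j = c i.
  by move=> jA; apply/eqP; rewrite eq_le !cle.
have : \sum_(j in A) c j = #|{perm 'I_N}|%:R.
  rewrite /c exchange_big -sumr_const; apply: eq_bigr => s _ /=.
  have [|j jA sj] := @first_of_some s A; first by apply/card_gt0P; exists i.
  rewrite sj (bigD1 j) //= eqxx big1 ?addr0 // => j' /andP[_ j'j].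
  by case: eqP => // -[jj']; rewrite jj' eqxx in j'j.
rewrite (eq_bigr _ cE) sumr_const -[c i *+ _]mulr_natr => cA.
have A0 : #|A|%:R != 0 :> R by rewrite pnatr_eq0 -lt0n; apply/card_gt0P; exists i.
have S0 : #|{perm 'I_N}|%:R != 0 :> R.
  by rewrite pnatr_eq0 -lt0n card_perm_gt0.
by apply: (mulIf A0); rewrite mulVf // /avg -/(c i) mulrAC cA divff.
Qed.

End RandomOrder.

Fixpoint seeds N l : finType :=
  if l is l'.+1 then ({perm 'I_N} * seeds N l')%type else unit.

Lemma card_seeds_gt0 N l : (0 < #|seeds N l|)%N.
Proof.
elim: l => [|l IH]; first by rewrite card_unit.
by rewrite card_prod muln_gt0 IH card_perm_gt0.
Qed.

End Average.

(** * Lower bound on the optimum *)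

Section PathCost.
Context {R : realType} {k : nat} {M : 'I_k -> eqType}.
Context (u : 'I_k -> R) (u0 : forall l, 0 <= u l).
Implicit Types (s t : config M) (ss : seq (config M)).

Lemma wdistC l (x y : M l) : wdist u x y = wdist u y x.
Proof. by rewrite /wdist eq_sym. Qed.

Lemma move_costC s t : move_cost u s t = move_cost u t s.
Proof. by apply: eq_bigr => l _; apply: wdistC. Qed.

Lemma move_cost_id s : move_cost u s s = 0.
Proof. by apply: big1 => l _; rewrite /wdist eqxx. Qed.

Lemma move_cost_triangle s t s' :
  move_cost u s s' <= move_cost u s t + move_cost u t s'.
Proof.
rewrite /move_cost -big_split; apply: ler_sum => l _; rewrite /wdist /=.
case: (s l =P t l) => [->|_]; first by rewrite add0r.
by case: ifP => _; rewrite ?addr_ge0 ?lerDl //; case: ifP.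
Qed.

Lemma move_cost_ge_wdist s t l : wdist u (s l) (t l) <= move_cost u s t.
Proof.
rewrite /move_cost (bigD1 l) //= lerDl; apply: sumr_ge0 => i _.
by rewrite /wdist; case: ifP.
Qed.

Lemma total_cost_cat s ss1 ss2 :
  total_cost u s (ss1 ++ ss2) = total_cost u s ss1 + total_cost u (last s ss1) ss2.
Proof. by elim: ss1 s => [|t ss1 IH] s /=; rewrite ?add0r // IH addrA. Qed.

Lemma total_cost_restart s t ss :
  total_cost u s ss <= move_cost u s t + total_cost u t ss.
Proof.
case: ss => [|s' ss] /=; first by rewrite addr0 move_cost_ge0.
by rewrite addrA lerD2r move_cost_triangle.
Qed.

Lemma total_cost_filter (Z : Type) (f : Z -> config M) (a : pred Z) s z :
  total_cost u s [seq f i | i <- z & a i] <= total_cost u s (map f z).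
Proof.
elim: z s => //= i z IH s; case: ifP => _ /=; first by rewrite lerD2l.
exact: le_trans (IH s) (total_cost_restart _ _ _).
Qed.

Lemma total_cost_has_move l s ss :
  has (fun t => t l != s l) ss -> u l <= total_cost u s ss.
Proof.
elim: ss s => //= t ss IH s.
case: eqVneq => [ts /= hs|ts _].
  by rewrite (le_trans (IH t _)) ?ts // lerDr move_cost_ge0.
rewrite (le_trans _ (_ : move_cost u s t <= _)) ?lerDl ?total_cost_ge0 //.
rewrite (le_trans _ (move_cost_ge_wdist s t l)) // /wdist eq_sym.
by rewrite (negPf ts).
Qed.

(** Reaching the first configuration is free, which makes the cost superadditive under concatenation
    and invariant under reversal; the latter matters because histories run backwards. *)
Definition path_cost ss := if ss is s :: ss' then total_cost u s ss' else 0.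

Lemma path_cost_ge0 ss : 0 <= path_cost ss.
Proof. by case: ss => //= s ss; apply: total_cost_ge0. Qed.

Lemma path_cost_cat ss1 ss2 :
  path_cost ss1 + path_cost ss2 <= path_cost (ss1 ++ ss2).
Proof.
case: ss1 => [|s ss1] /=; first by rewrite add0r.
rewrite total_cost_cat lerD2l; case: ss2 => //= t ss2.
by rewrite lerDr move_cost_ge0.
Qed.

Lemma path_cost_filter (Z : Type) (f : Z -> config M) (a : pred Z) z :
  path_cost [seq f i | i <- z & a i] <= path_cost (map f z).
Proof.
elim: z => //= i z IH; case: ifP => _ /=; first exact: total_cost_filter.
by rewrite (le_trans IH) //; case: z {IH} => //= j z; rewrite lerDr move_cost_ge0.
Qed.

Lemma path_cost_rev ss : path_cost (rev ss) = path_cost ss.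
Proof.
elim: ss => // s ss IH; rewrite rev_cons.
case: ss IH => [|t ss] //;
  rewrite -[path_cost (_ :: _ :: _)]/(move_cost u s t + path_cost (t :: ss)).
move=> <-; rewrite rev_cons; case: (rev ss) => [|t' ss'] /=.
  by rewrite move_costC.
by rewrite total_cost_rcons last_rcons addrC move_costC.
Qed.

End PathCost.

Lemma ler_path_cost {R : realType} {k : nat} {M : 'I_k -> eqType}
    (u u' : 'I_k -> R) (ss : seq (config M)) :
  (forall l, u l <= u' l) -> path_cost u ss <= path_cost u' ss.
Proof.
move=> uu'; case: ss => //= s ss; elim: ss s => //= t ss IH s.
by rewrite lerD //; apply: ler_sum => l _; rewrite /wdist; case: ifP.
Qed.

Section LowerBound.
Context {R : realType} {k : nat} {M : 'I_k.+1 -> eqType} (w : 'I_k.+1 -> R).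
Context (w_gt0 : forall l, 0 < w l).
Context (w_le : forall i j : 'I_k.+1, (i <= j)%N -> w i <= w j).
Implicit Types (r s : config M) (h ss : seq (config M)).

(* Servers are numbered from 0, so level [l] involves the servers [i < l], the
   heaviest of which has weight [v l]; [v 0] is the junk value [w 0 = v 1]. *)
Definition level_weight l : R := w (inord l.-1).
Local Notation v := level_weight.

Lemma level_weight_gt0 l : 0 < v l.
Proof. exact: w_gt0. Qed.

Lemma ler_level_weight l l' : (l <= l' <= k.+1)%N -> v l <= v l'.
Proof. by move=> ll'; apply: w_le; rewrite !inordK; lia. Qed.

(** Rounding up keeps [mult l * v l] above [v l.+1]; since the ratio is at least 1 for [l <= k], it
    also stays below [2 * v l.+1]. *)
Definition mult l : nat := (Num.truncn (v l.+1 / v l)).+1.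

Lemma mult_lb l : v l.+1 <= (mult l)%:R * v l.
Proof.
rewrite -ler_pdivrMr ?level_weight_gt0 //.
have /andP[_ /ltW] := @truncn_itv _ (v l.+1 / v l)
  (ltW (divr_gt0 (level_weight_gt0 _) (level_weight_gt0 _))).
by [].
Qed.

Lemma mult_ub l : (l <= k)%N -> (mult l)%:R * v l <= 2 * v l.+1.
Proof.
move=> lk; rewrite -ler_pdivlMr ?level_weight_gt0 // -mulrA.
have /andP[+ _] := @truncn_itv _ (v l.+1 / v l)
  (ltW (divr_gt0 (level_weight_gt0 _) (level_weight_gt0 _))).
have : 1 <= v l.+1 / v l.
  by rewrite ler_pdivlMr ?level_weight_gt0 // mul1r ler_level_weight ?leqnSn.
rewrite /mult -natr1; lra.
Qed.

Definition serves_below l s r := [exists i : 'I_k.+1, (i < l)%N && (s i == r i)].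

Definition weight_below l (i : 'I_k.+1) : R := if (i < l)%N then w i else 0.

Lemma weight_below_ge0 l i : 0 <= weight_below l i.
Proof. by rewrite /weight_below; case: ifP => // _; apply: ltW. Qed.

Local Notation Z := (config M * config M)%type.
Implicit Types (z : seq Z).

Lemma map_split (T1 T2 : Type) (f : T1 -> T2) (t : seq T1) (s1 s2 : seq T2) :
  map f t = s1 ++ s2 ->
  exists t1 t2, [/\ t = t1 ++ t2, map f t1 = s1 & map f t2 = s2].
Proof.
move=> tE; exists (take (size s1) t), (drop (size s1) t).
by rewrite cat_take_drop map_take map_drop tE take_size_cat ?drop_size_cat.
Qed.

Lemma many_path_cost P n l c z :
  (forall z, P [seq p.1 | p <- z] ->
    all (fun p => serves_below l p.2 p.1) z ->
    c <= path_cost (weight_below l) [seq p.2 | p <- z]) ->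
  many P n [seq p.1 | p <- z] -> all (fun p => serves_below l p.2 p.1) z ->
  n%:R * c <= path_cost (weight_below l) [seq p.2 | p <- z].
Proof.
move=> Pc; elim: n z => [|n IH] z.
  by rewrite mul0r => _ _; apply/path_cost_ge0/weight_below_ge0.
move=> [h0 [h1 [h2 [/map_split [z0 [z' [-> _ /map_split [z1 [z2 [-> <- <-]]]]]]]]]].
move=> P1 P2; rewrite !all_cat !map_cat => /and3P[_ s1 s2].
rewrite -nat1r mulrDl mul1r.
rewrite (le_trans (lerD (Pc _ P1 s1) (IH _ P2 s2))) //.
have wb0 := weight_below_ge0 l.
rewrite (le_trans (path_cost_cat wb0 _ _)) //.
rewrite (le_trans _ (path_cost_cat wb0 _ _)) // lerDr.
exact: path_cost_ge0.
Qed.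

Lemma phase_path_cost (s0 : config M) l j z : (l <= k.+1)%N ->
  phase mult l j [seq p.1 | p <- z] ->
  all (fun p => serves_below l p.2 p.1) z ->
  v l <= path_cost (weight_below l) [seq p.2 | p <- z].
Proof.
have mult0 l' : (0 < mult l')%N by [].
elim: l j z => [|l IH] j z lk.
  (* Level 0 is vacuous: without any server, no request of a nonempty sequence can be served. *)
  by case: z => // p z _ /andP[/existsP[i]]; rewrite ltn0.
case: z => [|[r s] z] ph sz; first by case: (phase_nil mult0 s0 lk ph).
pose i : 'I_k.+1 := Ordinal lk; pose x : @point _ M := Tagged M (s i).
have viE : v l.+1 = w i by rewrite /level_weight; congr w; apply/val_inj; rewrite /= inordK.
case: (boolP (all (fun t => t i == s i) [seq p.2 | p <- z])) => [same|]; last first.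
  rewrite -has_predC => hz; have := total_cost_has_move (weight_below_ge0 l.+1) hz.
  by rewrite /weight_below /= ltnSn -viE.
set z0 := (r, s) :: z in ph sz *.
pose z1 := [seq p <- z0 | ~~ has (hits^~ p.1) [:: x]].
have /le_trans : v l.+1 <= (2 ^ j * mult l)%:R * v l.
  rewrite (le_trans (mult_lb l)) // ler_wpM2r ?(ltW (level_weight_gt0 _)) //.
  by rewrite ler_nat leq_pmull // expn_gt0.
apply.
have /le_trans : (2 ^ j * mult l)%:R * v l <= path_cost (weight_below l) [seq p.2 | p <- z1].
  apply: (@many_path_cost (phase mult l j)).
  - by move=> z'; apply: IH; apply: ltnW.
  - by have := ph x erefl; rewrite /avoid filter_map.
  have : all (fun p => (p.2 i == s i) && serves_below l.+1 p.2 p.1) z0.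
    move: same sz; rewrite all_map => same.
    by rewrite all_predI => ->; rewrite andbT /z0 /= eqxx.
  rewrite /z1 all_filter; apply: sub_all => -[r' s'] /= /andP[/eqP s'i].
  case/existsP => i' /andP[i'l /eqP s'E]; rewrite /hits /= orbF.
  apply/implyP => nr; apply/existsP; exists i'; rewrite s'E eqxx andbT.
  move: i'l; rewrite ltnS leq_eqVlt => /orP[/eqP i'E|//].
  have {}i'E : i' = i by apply: val_inj.
  by move: nr; rewrite -s'i -i'E s'E eqxx.
apply; rewrite (le_trans (path_cost_filter (weight_below_ge0 l) _ _ _)) //.
apply: ler_path_cost => i'; rewrite /weight_below.
case: ifP => [i'l|_]; first by rewrite ltnS ltnW.
exact: (weight_below_ge0 l.+1 i').
Qed.

End LowerBound.

(** * The algorithm *)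

Section Restart.
Context {k : nat} {M : 'I_k -> eqType} (P : seq (config M) -> Prop).
Implicit Types h : seq (config M).

(* The part of [h] since the last completion of a phase, when a new phase is
   started as soon as the current one satisfies [P]. *)
Fixpoint current h :=
  if h is r :: h' then
    if `[< P (r :: current h') >] then [::] else r :: current h'
  else [::].

Fixpoint completed h : nat :=
  if h is r :: h' then (`[< P (r :: current h') >] + completed h')%N else 0%N.

(* The shortest beginning of [h] satisfying [P], or [h] if there is none. *)
Fixpoint until h :=
  if h is r :: h' then if `[< P (until h') >] then until h' else r :: until h'
  else [::].

Lemma many_completed h : many P (completed h) h.
Proof.
suff [g [-> Pg]] : exists g, h = current h ++ g /\ many P (completed h) g.
  exact: many_catl.
elim: h => [|r h [g [hE Pg]]] /=; first by exists [::].
case: asboolP => Pr; last by exists g; rewrite /= -hE.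
by exists (r :: h); split=> //; exists [::], (r :: current h), g; rewrite /= -hE.
Qed.

Lemma current_not h : current h = [::] \/ ~ P (current h).
Proof. by case: h => [|r h] /=; [left|case: asboolP => ?; [left|right]]. Qed.

Lemma until_not h : ~ P (until h) -> until h = h.
Proof. by elim: h => //= r h IH; case: asboolP => //= Ph _; rewrite IH. Qed.

Lemma until_suffix h : exists g, h = g ++ until h.
Proof.
elim: h => [|r h [g hE]] /=; first by exists [::].
case: asboolP => Ph; first by exists (r :: g); rewrite /= -hE.
by exists [::]; rewrite until_not.
Qed.

End Restart.

(* Expected change of cost when the live candidates shrink from [A] to [A']:
   [X' i] and [X i] are the costs of following candidate [i] so far, before and
   after the step, and [V] bounds the cost of changing candidates. *)
Lemma potential_drop {R : realType} (I : finType) (A A' : {set I})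
    (X X' : I -> R) B V :
  A' \subset A -> (0 < #|A'|)%N -> 0 <= B -> 0 <= V ->
  (forall i, i \in A -> X' i <= B) -> (forall i, i \in A' -> 0 <= X i) ->
  #|A|%:R^-1 * (\sum_(i in A) X' i) +
    \sum_(i in A) #|A|%:R^-1 * (if i \in A' then X i - X' i else V) <=
  (B + V) * (harm #|A| - harm #|A'|) + #|A'|%:R^-1 * (\sum_(i in A') X i).
Proof.
move=> A'A A'0 B0 V0 X'B X0; have cA := subset_leq_card A'A.
have A0 : (0 < #|A|)%N by apply: leq_trans cA.
rewrite -big_distrr -mulrDr -big_split /= (big_setID A') /= (finset.setIidPr A'A) mulrDr.
rewrite addrC lerD //.
  (* Dead candidates: each accounts for at most [B + V], and their proportion in [A] is at most a
     difference of harmonic numbers. *)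
  apply: (@le_trans _ _ ((B + V) * ((#|A| - #|A'|)%:R / #|A|%:R))); last first.
    by rewrite ler_wpM2l ?addr_ge0 // harm_sub.
  rewrite mulrA mulrC ler_wpM2r ?invr_ge0 // mulrC.
  have -> : (#|A| - #|A'|)%N = #|A :\: A'| by rewrite cardsD (finset.setIidPr A'A).
  rewrite mulr_natl -sumr_const; apply: ler_sum => i; rewrite !inE => /andP[/negPf -> iA].
  by rewrite lerD2r X'B.
rewrite (eq_bigr X) => [|i ->]; last by rewrite addrC subrK.
rewrite ler_wpM2r ?sumr_ge0 // lef_pV2 ?posrE ?ltr0n // ler_nat //.
Qed.

Section Strategy.
Context {R : realType} {k : nat} {M : 'I_k.+1 -> eqType} (w : 'I_k.+1 -> R).
Context (w_gt0 : forall l, 0 < w l).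
Context (w_le : forall i j : 'I_k.+1, (i <= j)%N -> w i <= w j).
Context (s0 : config M) (N : nat).
Implicit Types (r s : config M) (h : seq (config M)) (f : seq (config M) -> config M).

Local Notation phase := (phase (mult w)).
Local Notation v := (level_weight w).

(** [phase l.+1 j h] unfolds to [long l j] on the requests avoiding each point of tag [l]. *)
Definition long l j := many (phase l j : seq (config M) -> Prop) (2 ^ j * mult w l).

Definition candidate_list l j h (X : seq (@point _ M)) :=
  (size X <= N)%N /\
  forall x : point, tag x = l :> nat -> ~ long l j (avoid [:: x] h) -> x \in X.

Definition candidates l j h : seq point :=
  if pselect (exists X, candidate_list l j h X) is left ex then sval (cid ex)
  else [::].

(** Indices past the end of the list give a default point, and the list may contain points of other
    tags; [live] retains an index only if its point has the right tag and still survives, which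
    suffices. *)
Definition cand l j h (i : 'I_N) : @point _ M :=
  nth (Tagged M (s0 ord0)) (candidates l j h) i.

(* [u] is the earlier history at which the list of candidates was drawn up. *)
Definition live l j u h : {set 'I_N} :=
  [set i | (tag (cand l j u i) == l :> nat) &&
           ~~ `[< long l j (avoid [:: cand l j u i] h) >]].

Definition upd s (x : point) : config M := eqtype.dfwith s (tagged x).

(** Here [h] is the history within one phase. Stage one runs level [l'] at strength [j.+1]; stage
    two, once [u] is long, runs it at strength [j], with the same lower seeds [o.2]. The [s0] of the
    case without live candidates is a default, excluded by [live_gt0] until the phase ends. *)
Fixpoint pos l : nat -> seeds N l -> seq (config M) -> config M :=
  match l return nat -> seeds N l -> seq (config M) -> config M with
  | 0 => fun _ _ _ => s0
  | l'.+1 => fun j o h =>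
    let u := until (long l' j.+1) h in
    if `[< long l' j.+1 u >] then
      if first_of o.1 (live l' j u h) is Some i then
        let x := cand l' j u i in
        upd (pos j o.2 (current (phase l' j) (avoid [:: x] h))) x
      else s0
    else pos j.+1 o.2 (current (phase l' j.+1) h)
  end.

Definition restart l j (o : seeds N l) h := pos j o (current (phase l j) h).

(* A request completing a phase of some level may remain unserved by [pos]; it
   is charged [w ord0], the price of serving it with the lightest server. *)
Fixpoint raw_cost l f h : R :=
  if h is r :: h' then
    raw_cost l f h' +
      (move_cost w (f h') (f h) + w ord0 *+ ~~ serves_below l (f h) r)
  else 0.

Lemma raw_cost_cons l f r h : raw_cost l f (r :: h) = raw_cost l f h +
  (move_cost w (f h) (f (r :: h)) + w ord0 *+ ~~ serves_below l (f (r :: h)) r).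
Proof. by []. Qed.

Lemma raw_cost_ge0 l f h : 0 <= raw_cost l f h.
Proof.
elim: h => //= r h IH; rewrite !addr_ge0 ?mulrn_wge0 ?(ltW (w_gt0 _)) //.
by apply: move_cost_ge0 => i; apply: ltW.
Qed.

Lemma upd_tag s (x : point) : upd s x (tag x) = tagged x.
Proof. by rewrite /upd dfwith_in. Qed.

Lemma upd_out s (x : point) i : tag x != i -> upd s x i = s i.
Proof. exact: dfwith_out. Qed.

Lemma move_cost_upd s s' (x : point) :
  move_cost w (upd s x) (upd s' x) <= move_cost w s s'.
Proof.
apply: ler_sum => i _; case: (eqVneq (tag x) i) => [<-|xi].
  by rewrite !upd_tag /wdist eqxx; case: ifP => // _; apply: ltW.
by rewrite !upd_out.
Qed.

Lemma live_sub l j u r h : live l j u (r :: h) \subset live l j u h.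
Proof.
apply/fintype.subsetP => i; rewrite !inE => /andP[-> /=]; apply: contra => /asboolP li.
by apply/asboolP; rewrite -[r :: h]cat1s avoid_cat; apply: many_catl.
Qed.

Lemma pos_above l j (o : seeds N l) h (i : 'I_k.+1) : (l <= i)%N -> pos j o h i = s0 i.
Proof.
elim: l j o h => [|l IH] j o h //= li; case: asboolP => _; last exact/IH/ltnW.
case E : first_of => [c|//]; have := first_of_mem E.
rewrite inE => /andP[/eqP tc _]; rewrite upd_out ?IH ?(ltnW li) //.
by apply: contraTN li => /eqP <-; rewrite tc ltnn.
Qed.

Lemma pos_nil l j (o : seeds N l) : (l <= k.+1)%N -> pos j o [::] = s0.
Proof.
elim: l j o => [|l IH] j o lk //=; case: asboolP => [/many_nil|_].
  by rewrite mult_gt0 // => /(_ isT) /(phase_nil _ s0 (ltnW lk)) [].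
exact/IH/ltnW.
Qed.

Lemma step_cost_le l s s' r : (l <= k.+1)%N ->
  (forall i : 'I_k.+1, (l <= i)%N -> s i = s' i) ->
  move_cost w s s' + w ord0 *+ ~~ serves_below l s' r <= k.+2%:R * v l.
Proof.
move=> lk ss'; rewrite -natr1 mulrDl mul1r lerD //.
  rewrite mulr_natl -[X in _ *+ X]card_ord -sumr_const; apply: ler_sum => i _.
  rewrite /wdist; case: eqP => [_|si]; first exact/ltW/level_weight_gt0.
  case: (leqP l i) => [/ss'//|il].
  by apply: w_le; rewrite inordK; lia.
have w0v : w ord0 <= v l by apply: w_le.
by case: serves_below => //=; apply/ltW/level_weight_gt0.
Qed.

(** A completed phase costs at most [B] before its last request, and the reset at that request at
    most [k.+2%:R * v l]. The successor accounts for the unfinished phase. *)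
Lemma raw_cost_restart l j B h : (l <= k.+1)%N ->
  (forall h, ~ phase l j h -> avg (fun o : seeds N l => raw_cost l (pos j o) h) <= B) ->
  0 <= B ->
  avg (fun o : seeds N l => raw_cost l (restart j o) h) <=
    (completed (phase l j) h).+1%:R * (B + k.+2%:R * v l).
Proof.
move=> lk PB B0.
have V0 : 0 <= k.+2%:R * v l by rewrite mulr_ge0 // ltW // level_weight_gt0.
have curB g : avg (fun o : seeds N l => raw_cost l (pos j o) (current (phase l j) g)) <= B.
  case: (current_not (phase l j) g) => [-> /=|/PB //].
  by rewrite avg_cst ?card_seeds_gt0.
suff : avg (fun o : seeds N l => raw_cost l (restart j o) h) <=
    (completed (phase l j) h)%:R * (B + k.+2%:R * v l) +
    avg (fun o : seeds N l => raw_cost l (pos j o) (current (phase l j) h)).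
  by have := curB h; rewrite -natr1 mulrDl mul1r; lra.
elim: h => [|r h IH] /=; first by rewrite mul0r add0r.
rewrite /restart /=; case: asboolP => ph /=.
  rewrite avg_cst ?card_seeds_gt0 // addr0 natrD mulrDl mul1r.
  apply: (@le_trans _ _ (avg (fun o : seeds N l =>
    raw_cost l (restart j o) h + k.+2%:R * v l))).
    apply: avg_le => o; rewrite lerD2l /restart; apply: step_cost_le => // i li.
    by rewrite !pos_above.
  rewrite avgD avg_cst ?card_seeds_gt0 //; have := curB h; lra.
rewrite !avgD add0n; lra.
Qed.

Lemma not_long_completed l j h : ~ long l j h ->
  (completed (phase l j) h < 2 ^ j * mult w l)%N.
Proof.
by rewrite ltnNge => nl; apply/negP => le; apply/nl/(many_le le)/many_completed.
Qed.


Context (N_large : forall l, (l <= k)%N -> (2 * killer_bound k.+1 l 1 <= N)%N).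

(** An instance of [many_killers] for single points, [K = 1], whence the factor 2 in [N_large]. *)
Lemma candidatesP l j h (x : point) : (l <= k)%N -> long l j.+1 h ->
  tag x = l :> nat -> ~ long l j (avoid [:: x] h) ->
  exists2 i : 'I_N, cand l j h i = x & x \in candidates l j h.
Proof.
move=> lk lh tx nx.
have [X sX XP] : exists2 X : seq point, (size X <= N)%N &
    forall x : point, tag x = l :> nat -> ~ long l j (avoid [:: x] h) -> x \in X.
  have mult_gt l' : (0 < mult w l')%N by [].
  have := @many_killers _ _ _ _ _ 1 _ (mult_gt0 mult_gt j l)
    (@phase_killers _ _ _ mult_gt s0 l j 1 (leqW lk)) h.
  rewrite -mul2n mulnA -expnS => /(_ lh) [X sX XP].
  exists X; first exact: leq_trans sX (N_large lk).
  by move=> y ty ny; have := XP [:: y] isT ny; rewrite /= orbF.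
have [sc xc] : candidate_list l j h (candidates l j h).
  by rewrite /candidates; case: pselect => [ex|[]]; [case: (cid ex)|exists X].
have xin := xc x tx nx.
have ix : (index x (candidates l j h) < N)%N by rewrite (leq_trans _ sc) ?index_mem.
by exists (Ordinal ix) => //; rewrite /cand /= nth_index.
Qed.

(** An unfinished phase has a point [x] for which [long] fails on [h], hence also on the earlier
    history at which the list was drawn up; so [x] is listed, and it is live. *)
Lemma live_gt0 l j h : (l <= k)%N -> long l j.+1 (until (long l j.+1) h) ->
  ~ phase l.+1 j h -> (0 < #|live l j (until (long l j.+1) h) h|)%N.
Proof.
move=> lk lu /existsNP[x /not_implyP[tx nx]].
have [|i ix _] := candidatesP lk lu tx.
  have [g hE] := until_suffix (long l j.+1) h.
  by apply: contra_not nx => lx; rewrite hE avoid_cat; apply: many_catl.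
by apply/card_gt0P; exists i; rewrite inE ix tx eqxx /=; apply/asboolPn.
Qed.

(** Only the first live candidate contributes. If it dies, one step of the level is charged;
    otherwise it remains first and the step costs no more than that of the lower level on the
    requests avoiding it. *)
Lemma phase_step_live l j r h (o : seeds N l.+1) :
  let u := until (long l j.+1) h in
  let A := live l j u h in let A' := live l j u (r :: h) in
  let x := raw_cost l (restart j o.2) in
  (l <= k)%N -> long l j.+1 u -> (0 < #|A|)%N ->
  move_cost w (pos j o h) (pos j o (r :: h)) +
      w ord0 *+ ~~ serves_below l.+1 (pos j o (r :: h)) r <=
    \sum_(i in A) (first_of o.1 A == Some i)%:R *
      (if i \in A' then x (avoid [:: cand l j u i] (r :: h)) -
                         x (avoid [:: cand l j u i] h)
       else k.+2%:R * v l.+1).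
Proof.
move=> u A A' x lk lu A0.
have [c cA cE] := first_of_some o.1 A0.
rewrite (bigD1 c) // [leRHS]/= cE eqxx mul1r big1 ?addr0; last first.
  by move=> i /andP[_ ic]; case: eqP => [[ci]|_]; rewrite ?mul0r //; rewrite ci eqxx in ic.
case: ifP => cA'; last by apply: step_cost_le => // i li; rewrite !pos_above.
have cE' := first_of_sub (live_sub l j u r h) cE cA'.
rewrite /= -/(until _ h) -/u !asboolT // cE cE' -/(restart _ _ _).
have tc : tag (cand l j u c) = l :> nat by move: cA; rewrite inE => /andP[/eqP].
set y := cand l j u c in tc *.
rewrite -!/(restart _ _ _).
have avE : avoid [:: y] (r :: h) =
    if hits y r then avoid [:: y] h else r :: avoid [:: y] h.
  by rewrite /avoid /= orbF; case: (hits y r).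
have [yr|nyr] := boolP (hits y r).
  rewrite avE yr move_cost_id subrr add0r.
  suff -> : serves_below l.+1 (upd (restart j o.2 (avoid [:: y] h)) y) r by [].
  by apply/existsP; exists (tag y); rewrite tc ltnSn upd_tag eq_sym.
rewrite avE (negPf nyr) /x /= addrAC subrr add0r.
apply: lerD; first exact: move_cost_upd.
rewrite ler_wpMn2l ?(ltW (w_gt0 _)) //.
case: (boolP (serves_below l _ r)) => [/existsP[i /andP[il sr]]|_];
    last by case: serves_below.
suff -> : serves_below l.+1 (upd (restart j o.2 (r :: avoid [:: y] h)) y) r by [].
apply/existsP; exists i; rewrite ltnS ltnW // upd_out //.
by apply: contraTN il => /eqP <-; rewrite tc ltnn.
Qed.

Lemma phase_cost_step l j C : (l <= k)%N -> 0 <= C ->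
  (forall j' h, (j <= j' <= j.+1)%N -> ~ phase l j' h ->
     avg (fun o : seeds N l => raw_cost l (pos j' o) h) <= C * v l) ->
  forall h, ~ phase l.+1 j h ->
    avg (fun o : seeds N l.+1 => raw_cost l.+1 (pos j o) h) <=
      2 ^+ j.+3 * (harm N + 1) * (C + k.+2%:R) * v l.+1.
Proof.
move=> lk C0 PC.
have vl0 : 0 <= v l by apply/ltW/level_weight_gt0.
have vl1 : 0 <= v l.+1 by apply/ltW/level_weight_gt0.
set D := C + k.+2%:R; have D0 : k.+2%:R <= D by rewrite lerDr.
have restart_le j' h : (j <= j' <= j.+1)%N -> ~ long l j' h ->
    avg (fun o : seeds N l => raw_cost l (restart j' o) h) <= 2 ^+ j'.+1 * D * v l.+1.
  move=> jj /not_long_completed nc.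
  have := raw_cost_restart h (leqW lk) (fun g => PC j' g jj) (mulr_ge0 C0 vl0).
  move/le_trans; apply; rewrite -mulrDl -/D.
  have D0' : 0 <= D by apply: le_trans D0.
  apply: (@le_trans _ _ ((2 ^ j' * mult w l)%:R * (D * v l))).
    by rewrite ler_wpM2r ?mulr_ge0 // ler_nat.
  have -> : (2 ^ j' * mult w l)%:R * (D * v l) = 2 ^+ j' * D * ((mult w l)%:R * v l).
    by rewrite natrM natrX; ring.
  have -> : 2 ^+ j'.+1 * D * v l.+1 = 2 ^+ j' * D * (2 * v l.+1) by rewrite exprS; ring.
  by rewrite ler_wpM2l ?mult_ub // mulr_ge0 ?exprn_ge0.
pose V := k.+2%:R * v l.+1; have V0 : 0 <= V by rewrite mulr_ge0.
(* [B] bounds the average cost of following a live candidate; [S] bounds that of stage one, plus [V]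
   for the step that enters stage two. *)
pose B := 2 ^+ j.+1 * D * v l.+1.
have B0 : 0 <= B by rewrite !mulr_ge0 ?exprn_ge0 // (le_trans _ D0).
pose S := 2 ^+ j.+2 * D * v l.+1 + V.
pose X u h i := avg (fun o : seeds N l =>
  raw_cost l (restart j o) (avoid [:: cand l j u i] h)).
have X0 u h i : 0 <= X u h i by apply: avg_ge0 => o; apply: raw_cost_ge0.
have XB u h i : i \in live l j u h -> X u h i <= B.
  by rewrite inE => /andP[_ /asboolPn nl]; apply: restart_le; rewrite ?leqnn ?leqnSn.
pose cost h := avg (fun o : seeds N l.+1 => raw_cost l.+1 (pos j o) h).
pose u h := until (long l j.+1) h.
pose A h := live l j (u h) h.
(* Stage one is dominated, for every seed, by level [l] at strength [j.+1]. In stage two the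
   harmonic potential pays, on average, for the changes of candidate. *)
have main h : ~ phase l.+1 j h ->
    (~ long l j.+1 (u h) -> forall o : seeds N l.+1,
       raw_cost l.+1 (pos j o) h <= raw_cost l (restart j.+1 o.2) h) /\
    (long l j.+1 (u h) -> cost h <= S + (B + V) * (harm N - harm #|A h|) +
      #|A h|%:R^-1 * (\sum_(i in A h) X (u h) h i)).
  elim: h => [_|r h IH ph].
    split=> //= /many_nil; rewrite mult_gt0 // => /(_ isT).
    by move=> /(phase_nil _ s0 (leqW lk)) [].
  have [|IH1 IH2] := IH; first by move=> /(phase_cons r).
  have step_le (o : seeds N l.+1) :
      raw_cost l.+1 (pos j o) (r :: h) <= raw_cost l.+1 (pos j o) h + V.
    by rewrite lerD2l; apply: step_cost_le => // i li; rewrite !pos_above.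
  case: (pselect (long l j.+1 (u h))) => lu.
    have uE : u (r :: h) = u h by rewrite /u /= asboolT.
    split; rewrite uE // => _.
    have ph' : ~ phase l.+1 j h by move=> /(phase_cons r).
    have A0 := live_gt0 lk lu ph'.
    have lur : long l j.+1 (u (r :: h)) by rewrite uE.
    have A'0 : (0 < #|A (r :: h)|)%N := live_gt0 lk lur ph.
    pose x (i : 'I_N) (o : seeds N l) := if i \in A (r :: h) then
      raw_cost l (restart j o) (avoid [:: cand l j (u h) i] (r :: h)) -
      raw_cost l (restart j o) (avoid [:: cand l j (u h) i] h) else V.
    have xE i : avg (x i) =
        if i \in A (r :: h) then X (u h) (r :: h) i - X (u h) h i else V.
      rewrite /x; case: ifP => _; last by rewrite avg_cst ?card_seeds_gt0.
      by rewrite avgD -mulN1r -avgZ; congr (_ + _); apply: eq_avg => o; rewrite mulN1r.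
    have : cost (r :: h) <= cost h +
        avg (fun o : seeds N l.+1 =>
          \sum_(i in A h) (first_of o.1 (A h) == Some i)%:R * x i o.2).
      rewrite -avgD; apply: avg_le => o; rewrite lerD2l.
      by have := phase_step_live r o lk lu A0; rewrite /x /A uE.
    (* The top order is independent of the lower seeds, so the indicator averages to [#|A h|%:R^-1]
       separately. *)
    rewrite avg_pair /=; under eq_avg do rewrite avg_sum.
    rewrite avg_sum => /le_trans; apply.
    rewrite (eq_bigr (fun i => #|A h|%:R^-1 *
      if i \in A (r :: h) then X (u h) (r :: h) i - X (u h) h i else V)); last first.
      move=> i iA; under eq_avg do rewrite avgZ xE mulrC.
      by rewrite avgZ avg_first_of // mulrC.
    have AA : A (r :: h) \subset A h by rewrite /A uE live_sub.
    have := potential_drop AA A'0 B0 V0 (fun i => @XB (u h) h i)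
      (fun i _ => X0 (u h) (r :: h) i).
    by have := IH2 lu; lra.
  have uE : u h = h by apply: until_not.
  have urE : u (r :: h) = r :: h by rewrite /u /= asboolF // -/(u h) uE.
  have cost_h : cost h <= S - V.
    apply: (@le_trans _ _ (avg (fun o : seeds N l.+1 =>
      raw_cost l (restart j.+1 o.2) h))).
      by apply: avg_le => o; apply: IH1.
    rewrite avg_pair /= avg_cst; last exact: card_perm_gt0.
    by rewrite /S addrK restart_le ?leqnn ?leqnSn // -uE.
  split=> [nlu o|_].
    have posE g : ~ long l j.+1 (u g) -> pos j o g = restart j.+1 o.2 g.
      by move=> lg; rewrite /= asboolF.
    rewrite !raw_cost_cons !posE // lerD ?IH1 // lerD2l.
    rewrite ler_wpMn2l ?(ltW (w_gt0 _)) //.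
    case: (boolP (serves_below l _ r)) => [/existsP[i /andP[il sr]]|_];
    last by case: serves_below.
    suff -> : serves_below l.+1 (restart j.+1 o.2 (r :: h)) r by [].
    by apply/existsP; exists i; rewrite ltnS ltnW.
  rewrite (@le_trans _ _ (cost h + V)) //.
    apply: (@le_trans _ _ (avg (fun o => raw_cost l.+1 (pos j o) h + V))).
      exact: avg_le.
    by rewrite avgD avg_cst // card_seeds_gt0.
  rewrite -addrA (@le_trans _ _ S) ?lerDl -?lerBrDr // addr_ge0 //.
    rewrite mulr_ge0 ?(addr_ge0 B0 V0) // subr_ge0 ler_harm //.
    by rewrite -[X in (_ <= X)%N]card_ord max_card.
  by rewrite mulr_ge0 ?invr_ge0 ?sumr_ge0.
move=> h ph; have [stage1 stage2] := main h ph.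
have BV : S + (B + V) * harm N + B <= 2 ^+ j.+3 * (harm N + 1) * D * v l.+1.
  have D0' : 0 <= D * v l.+1 by rewrite mulr_ge0 // (le_trans _ D0).
  have VD : V <= D * v l.+1 by rewrite ler_wpM2r.
  have p1 : 1 <= 2 ^+ j :> R by rewrite exprn_ege1 // ler1n.
  have H0 := @harm_ge0 R N.
  move: VD D0'; rewrite /S /B !exprS -!mulrA; set a := 2 ^+ j in p1 *.
  set Dv := D * v l.+1; set H := harm N in H0 *; move=> VD D0'.
  have aD : Dv <= a * Dv by rewrite ler_peMl.
  have a0 : 0 <= a by apply: le_trans p1.
  have HaD : 0 <= H * (a * Dv) := mulr_ge0 H0 (mulr_ge0 a0 D0').
  have HV : H * V <= H * (a * Dv) by rewrite ler_wpM2l // (le_trans VD).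
  nra.
have HA : 0 <= (B + V) * harm #|A h| by rewrite !mulr_ge0 ?addr_ge0 ?harm_ge0.
have HN : 0 <= (B + V) * harm N by rewrite !mulr_ge0 ?addr_ge0 ?harm_ge0.
rewrite (le_trans _ BV) // -/(cost h).
case: (pselect (long l j.+1 (u h))) => lu; last first.
  apply: (@le_trans _ _ (avg (fun o : seeds N l.+1 =>
      raw_cost l (restart j.+1 o.2) h))).
    by apply: avg_le => o; apply: stage1.
  rewrite avg_pair /= avg_cst; last exact: card_perm_gt0.
  have uE : u h = h by apply: until_not.
  have := @restart_le j.+1 h; rewrite leqnn leqnSn -uE => /(_ isT lu).
  rewrite uE /S; lra.
have A0 := live_gt0 lk lu ph.
have : #|A h|%:R^-1 * (\sum_(i in A h) X (u h) h i) <= B.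
  rewrite mulrC ler_pdivrMr ?ltr0n // mulr_natr -sumr_const.
  by apply: ler_sum => i; apply: XB.
have := stage2 lu; lra.
Qed.

Definition level_factor : R := 2 ^+ k.+3 * (harm N + 1).

Fixpoint phase_ratio l : R :=
  if l is l'.+1 then level_factor * (phase_ratio l' + k.+2%:R) else 0.

Lemma phase_ratio_ge0 l : 0 <= phase_ratio l.
Proof.
elim: l => //= l IH.
have L0 : 0 <= level_factor by rewrite mulr_ge0 ?exprn_ge0 // addr_ge0 ?harm_ge0.
by rewrite mulr_ge0 // addr_ge0.
Qed.

(** The condition on [l + j] survives the recursion, as each level down raises the strength by at
    most one; it gives [j <= k] at positive levels, whence [k.+3] in [level_factor]. *)
Lemma phase_cost l j h : (l + j <= k.+1)%N -> ~ phase l j h ->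
  avg (fun o : seeds N l => raw_cost l (pos j o) h) <= phase_ratio l * v l.
Proof.
elim: l j h => [|l IH] j h ljk.
  by case: h => [|r h []//]; rewrite avg_cst ?card_unit ?mul0r.
move=> ph; have lk : (l <= k)%N by lia.
have step := phase_cost_step lk (phase_ratio_ge0 l) _ ph.
apply: (le_trans (step _)).
  by move=> j' h' jj nph; apply: IH => //; lia.
rewrite /= ler_wpM2r ?(ltW (level_weight_gt0 _ _)) //.
have D0 : 0 <= phase_ratio l + k.+2%:R by rewrite addr_ge0 ?phase_ratio_ge0.
rewrite ler_wpM2r // /level_factor ler_wpM2r ?addr_ge0 ?harm_ge0 //.
by rewrite ler_weXn2l ?ler1n //; lia.
Qed.

Lemma restart_cost h :
  avg (fun o : seeds N k.+1 => raw_cost k.+1 (restart 0 o) h) <=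
    (completed (phase k.+1 0) h).+1%:R * ((phase_ratio k.+1 + k.+2%:R) * v k.+1).
Proof.
rewrite [(_ + _) * _]mulrDl; apply: raw_cost_restart => //.
  by move=> g; apply: phase_cost; rewrite addn0.
by rewrite mulr_ge0 ?phase_ratio_ge0 // ltW // level_weight_gt0.
Qed.

End Strategy.

(** * Competitiveness *)

Section UniformNat.
Context {R : realType} (n : nat).

(** Every subset of [nat] is measurable, so the measurability fields of [randomized_algorithm]
    become trivial. *)
Definition uniform_nat : set nat -> \bar R :=
  msum (fun i => mscale (n.+1%:R^-1 : R)%:nng \d_i) n.+1.

HB.instance Definition _ := Measure.on uniform_nat.

Let uniform_nat_setT : uniform_nat setT = 1%E.
Proof.
rewrite /uniform_nat /msum /= (eq_bigr (fun=> (n.+1%:R^-1)%:E)) => [|i _].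
  by rewrite sumEFin sumr_const card_ord -[_ *+ _]mulr_natl divff.
by rewrite /mscale /= diracT mule1.
Qed.

HB.instance Definition _ :=
  @Measure_isProbability.Build _ _ R uniform_nat uniform_nat_setT.

Local Open Scope ereal_scope.

Lemma integral_uniform_nat (f : nat -> R) : (forall i, (0 <= f i)%R) ->
  \int[uniform_nat]_i (f i)%:E = (\sum_(i < n.+1) f i / n.+1%:R)%R%:E.
Proof.
move=> f0; rewrite ge0_integral_measure_sum //= => [|i _]; last by rewrite lee_fin.
rewrite -sumEFin; apply: eq_bigr => i _.
rewrite ge0_integral_mscale //= => [|j _]; last by rewrite lee_fin.
by rewrite integral_dirac //= diracT mul1e -EFinM mulrC.
Qed.

End UniformNat.

(** * From strategies with penalties to online algorithms *)

Section Implementation.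
Context {R : realType} {k : nat} {M : 'I_k.+1 -> eqType} (w : 'I_k.+1 -> R).
Context (w_ge0 : forall l, 0 <= w l) (s0 : config M).
Implicit Types (r s : config M) (h rho : seq (config M)).
Implicit Types (f : seq (config M) -> config M).

Definition repair f h : config M :=
  if h is r :: _ then
    if serves (f h) r then f h else upd (f h) (Tagged M (r ord0))
  else s0.

Lemma repair_serves f r h : serves (repair f (r :: h)) r.
Proof.
rewrite /=; case: ifP => // _; apply/existsP; exists ord0.
by rewrite (@upd_tag _ _ _ (Tagged M (r ord0))).
Qed.

Lemma repair_alg_serves f h r : serves (repair f (rev (rcons h r))) r.
Proof. by rewrite rev_rcons repair_serves. Qed.

Definition repaired_alg f : online_algorithm s0 :=
  @OnlineAlgorithm _ M s0 (fun h => repair f (rev h)) erefl (repair_alg_serves f).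

Lemma move_cost_upd_le s (x : point) : move_cost w s (upd s x) <= w (tag x).
Proof.
rewrite /move_cost (bigD1 (tag x)) //= big1 => [|i ix].
  by rewrite addr0 /wdist; case: ifP.
by rewrite upd_out 1?eq_sym // /wdist eqxx.
Qed.

Lemma serves_belowE s r : serves_below k.+1 s r = serves s r.
Proof. by apply: eq_existsb => i; rewrite ltn_ord. Qed.

(** The potential is the distance from the actual configuration to that of [f]. A detour of the
    lightest server is paid twice, out and back, whence the factor 2. *)
Lemma repaired_alg_cost f rho : f [::] = s0 ->
  total_cost w s0 (run (repaired_alg f) rho) <= 2 * raw_cost w k.+1 f (rev rho).
Proof.
move=> f0; set A := repaired_alg f.
suff : total_cost w s0 (run A rho) + move_cost w (A rho) (f (rev rho)) <=
    2 * raw_cost w k.+1 f (rev rho).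
  by apply: le_trans; rewrite lerDl move_cost_ge0.
elim/last_ind: rho => [|rho r IH]; first by rewrite /= f0 move_cost_id mulr0 addr0.
rewrite run_rcons total_cost_rcons last_run rev_rcons raw_cost_cons serves_belowE.
set a := A rho; set a' := A _; set b := f (rev rho) in IH *; set b' := f (r :: _).
have aab := move_cost_triangle w_ge0 a b a'.
have bba := move_cost_triangle w_ge0 b b' a'.
have m0 : 0 <= move_cost w b b' by apply: move_cost_ge0.
have b'a' : move_cost w b' a' <= w ord0 *+ ~~ serves b' r.
  rewrite /a' /A /= rev_rcons /= -/b'; case: (serves b' r) => /=.
    by rewrite move_cost_id.
  exact: move_cost_upd_le (Tagged M (r ord0)).
rewrite (move_costC _ a' b'); lra.
Qed.

Lemma randomized_alg_exists (T : finType) (F : T -> seq (config M) -> config M) :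
  (0 < #|T|)%N -> (forall t, F t [::] = s0) ->
  exists A : @randomized_algorithm R _ M s0, forall rho,
    (ALG w A rho <= (2 * avg (fun t => raw_cost w k.+1 (F t) (rev rho)))%:E)%E.
Proof.
move=> /card_gt0P[t0 _] F0.
pose alg (i : nat) := repaired_alg (F (nth t0 (enum T) i)).
pose A := @RandomizedAlgorithm R _ M s0 _ _ (@uniform_nat R #|T|.-1) alg
  (fun _ _ _ => I) (fun _ _ _ => I).
exists A => rho; rewrite /ALG unlock /= integral_uniform_nat => [|i]; last first.
  exact: total_cost_ge0.
have T0 : (0 < #|T|)%N by apply/card_gt0P; exists t0.
rewrite prednK // lee_fin -avgZ /avg -big_distrl /= ler_wpM2r ?invr_ge0 //.
rewrite -[leRHS]big_enum (big_nth t0) big_mkord -cardE.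
by apply: ler_sum => i _; apply: repaired_alg_cost.
Qed.

End Implementation.

(** * Numerical bounds *)

Section Constants.
Context {R : realType} (k : nat).
Local Notation n := k.+1.

(** The factor [2 ^ (2 * n + 1)] normalises the recursion: as [u + u * u <= 2 * (2 ^ n * b) ^ 2],
    the left-hand side at most squares at each level. *)
Lemma killer_bound_le l K : (K + l <= n)%N ->
  (killer_bound n l K * 2 ^ (2 * n + 1) <= 2 ^ ((3 * n + 1) * 2 ^ l))%N.
Proof.
have kn : (n <= 2 ^ k)%N by apply: ltn_expl.
elim: l K => [|l IH] K Kn.
  rewrite expn0 muln1 (_ : 3 * n + 1 = n + (2 * n + 1))%N; last by lia.
  by rewrite [leqRHS]expnD leq_mul2r (ltnW (ltn_expl _ _)) ?orbT.
rewrite /= -/(killer_bound n l K.+1); set b := killer_bound _ _ _.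
have {IH} : (b * 2 ^ (2 * n + 1) <= 2 ^ ((3 * n + 1) * 2 ^ l))%N by apply: IH; lia.
have -> : (2 ^ (2 * n + 1) = 2 * (2 ^ n * 2 ^ n))%N.
  by rewrite -expnD -expnS; congr (2 ^ _)%N; lia.
have -> : (2 ^ ((3 * n + 1) * 2 ^ l.+1) =
    2 ^ ((3 * n + 1) * 2 ^ l) * 2 ^ ((3 * n + 1) * 2 ^ l))%N.
  by rewrite -expnD expnS; congr (2 ^ _)%N; lia.
move: (2 ^ ((3 * n + 1) * 2 ^ l))%N => X.
have up : (K.+1.*2 * b <= 2 ^ n * b)%N.
  by rewrite leq_mul2r expnS mul2n leq_double (leq_trans _ kn) ?orbT //; lia.
move: (K.+1.*2 * b)%N (2 ^ n)%N up (expn_gt0 2 n) => u p up p0 bX.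
apply: leq_trans (leq_mul bX bX).
rewrite (_ : b * _ * _ = (p * b * (p * b)) * 2 * (2 * (p * p)))%N; last by lia.
rewrite leq_mul2r; apply/orP; right.
apply: (@leq_trans (p * b + p * b * (p * b))); first by rewrite leq_add ?leq_mul.
rewrite muln2 -addnn leq_add2r; case: (p * b)%N => // c; exact: leq_pmulr.
Qed.

(** A power of two, so that [harm_exp2] applies directly. *)
Definition num_candidates : nat := 2 ^ ((3 * n + 1) * 2 ^ n).

Lemma num_candidates_ge l : (l <= k)%N -> (2 * killer_bound n l 1 <= num_candidates)%N.
Proof.
move=> lk; have := @killer_bound_le l 1 ltac:(lia).
have : (2 ^ ((3 * n + 1) * 2 ^ l) <= num_candidates)%N.
  by rewrite leq_exp2l // leq_mul2l leq_exp2l // (leq_trans lk) ?orbT.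
have : (2 <= 2 ^ (2 * n + 1))%N by rewrite addn1 expnS leq_pmulr ?expn_gt0.
set q := (2 ^ (2 * n + 1))%N => q2 XN bX; apply: leq_trans XN; apply: leq_trans bX.
by rewrite mulnC leq_mul2l q2 orbT.
Qed.

Lemma level_factor_le : @level_factor R k num_candidates <= 2 ^+ (7 * n) :> R.
Proof.
have -> : (7 * n = k.+3 + (5 * n - 2 + n))%N by lia.
rewrite /level_factor exprD ler_wpM2l ?exprn_ge0 //.
apply: le_trans (lerD (harm_exp2 _) (lexx 1)) _.
rewrite natr1 -natrX ler_nat.
have kn : (n <= 2 ^ k)%N by apply: ltn_expl.
have : (2 ^ (5 * n - 2) >= 8 * n)%N.
  apply: (@leq_trans (2 ^ 3 * 2 ^ k)); first by rewrite leq_mul2l kn orbT.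
  by rewrite -expnD leq_exp2l //; lia.
have : (2 <= 2 ^ n)%N by rewrite expnS leq_pmulr ?expn_gt0.
rewrite expnD; move: (2 ^ n)%N (2 ^ (5 * n - 2))%N => p q p2 q4.
apply: (@leq_trans (8 * n * p)); last by rewrite leq_mul2r q4 orbT.
nia.
Qed.

(** After adding [n.+1], each of the [n] levels multiplies by at most [2 ^+ (8 * n)], starting below
    [2 ^+ n]; and [1 + n + 8 * n ^ 2 <= 10 * n ^ 2]. *)
Lemma phase_ratio_le :
  2 * (@phase_ratio R k num_candidates n + n.+1%:R) <= 2 ^+ (10 * n ^ 2) :> R.
Proof.
have nn : (n.+1 <= 2 ^ n)%N by apply: ltn_expl.
have bound l : @phase_ratio R k num_candidates l + n.+1%:R <=
    2 ^+ n * (2 ^+ (8 * n)) ^+ l :> R.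
  elim: l => [|l IH] /=; first by rewrite add0r expr0 mulr1 -natrX ler_nat.
  set L := level_factor _; set D := phase_ratio _ _ + _.
  have nD : n.+1%:R <= D by rewrite lerDr phase_ratio_ge0.
  have D0 : 0 <= D by apply: le_trans nD.
  rewrite [(_ ^+ _) ^+ l.+1]exprSr mulrA.
  apply: (@le_trans _ _ (D * 2 ^+ (8 * n))); last first.
    by rewrite ler_wpM2r ?exprn_ge0.
  apply: (@le_trans _ _ (2 ^+ (7 * n) * D + D)).
    by rewrite lerD // ler_wpM2r // level_factor_le.
  rewrite mulrC -[X in _ + X]mulr1 -mulrDr ler_wpM2l //.
  rewrite (_ : 8 * n = 7 * n + n)%N ?exprD; last by lia.
  have e1 (m : nat) : 1 <= 2 ^+ m :> R by rewrite exprn_ege1 // ler1n.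
  have : 2 <= 2 ^+ n :> R by rewrite exprS ler_peMr.
  have := e1 (7 * n)%N; nra.
apply: (@le_trans _ _ (2 * (2 ^+ n * (2 ^+ (8 * n)) ^+ n))); first by rewrite ler_wpM2l.
rewrite -exprM -exprD -exprS ler_weXn2l ?ler1n //; nia.
Qed.

End Constants.

(** * Comparison with the optimum *)

Section Competitive.
Context {R : realType} {k : nat} {M : 'I_k.+1 -> eqType} (w : 'I_k.+1 -> R).
Context (s0 : config M).

Lemma OPT_ge0 rho : (forall l, 0 <= w l) -> 0 <= OPT w s0 rho.
Proof.
by move=> w0; have [//|ss _ <-] := @OPT_attained R _ M w s0 rho; apply: total_cost_ge0.
Qed.

Lemma completed_le_OPT (w_gt0 : forall l, 0 < w l) rho :
  (completed (phase (mult w) k.+1 0) (rev rho))%:R * level_weight w k.+1 <=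
    OPT w s0 rho.
Proof.
have w0 l : 0 <= w l by apply: ltW.
have [//|ss] := @OPT_attained R _ M w s0 rho.
rewrite /feasible all2E => /andP[/eqP sz sv] <-.
pose z := rev (zip rho ss).
have z1 : [seq p.1 | p <- z] = rev rho.
  by rewrite map_rev -/(unzip1 _) unzip1_zip // sz.
have z2 : [seq p.2 | p <- z] = rev ss.
  by rewrite map_rev -/(unzip2 _) unzip2_zip // sz.
have szv : all (fun p => serves_below k.+1 p.2 p.1) z.
  rewrite all_rev; elim: (rho) (ss) sv {sz z z1 z2} => [|r rho' IH] [|s ss'] //=.
  by rewrite serves_belowE => /andP[-> /IH].
have := @many_path_cost _ _ _ w w_gt0 (phase (mult w) k.+1 0) _ k.+1
  (level_weight w k.+1) z.
move=> /(_ (completed (phase (mult w) k.+1 0) (rev rho))).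
rewrite z1 z2 => /(_ _ (many_completed _ _) szv) /le_trans; apply.
  by move=> z' ph sz'; apply: (phase_path_cost w_gt0 s0 (leqnn _) ph sz').
rewrite (@le_trans _ _ (path_cost w (rev ss))) //.
  by apply: ler_path_cost => l; rewrite /weight_below ltn_ord.
rewrite path_cost_rev; case: (ss) => //= s ss'.
by rewrite lerDr move_cost_ge0.
Qed.

Lemma competitive_alg (w_ge0 : forall l, 0 <= w l)
    (w_le : forall i j : 'I_k.+1, (i <= j)%N -> w i <= w j) :
  exists A : @randomized_algorithm R _ M s0,
    competitive w A (2 * (@phase_ratio R k (num_candidates k) k.+1 + k.+2%:R)).
Proof.
set D := phase_ratio _ _ + _.
have D0 : 0 <= D by rewrite addr_ge0 ?phase_ratio_ge0.
(* If the lightest server is free, standing still and repairing costs nothing; otherwise all weights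
   are positive. *)
have [w0|w0] := eqVneq (w ord0) 0.
  have [A AP] := @randomized_alg_exists _ _ _ w w_ge0 s0 unit (fun _ _ => s0)
    ltac:(by rewrite card_unit) (fun=> erefl).
  exists A, 0 => rho; apply: (le_trans (AP rho)); rewrite lee_fin addr0.
  rewrite (@eq_avg _ _ _ (fun=> 0)) => [|_]; last first.
    by elim: (rev rho) => //= r h ->; rewrite move_cost_id w0 mul0rn !addr0.
  by rewrite avg_cst ?card_unit // mulr0 mulr_ge0 ?OPT_ge0 ?mulr_ge0.
have w_gt0 l : 0 < w l by rewrite (lt_le_trans _ (w_le ord0 l _)) // lt_def w0 w_ge0.
have [] := @randomized_alg_exists _ _ _ w w_ge0 s0 (seeds (num_candidates k) k.+1)
  (fun o => restart w s0 0 o) (card_seeds_gt0 _ _).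
  by move=> o; apply: pos_nil.
(* The additive constant pays for the last, unfinished phase. *)
move=> A AP; exists A, (2 * D * level_weight w k.+1) => rho.
apply: (le_trans (AP rho)); rewrite lee_fin.
have := restart_cost w_gt0 w_le s0 (@num_candidates_ge k) (rev rho).
have := completed_le_OPT w_gt0 rho.
rewrite -/D; set c := completed _ _; set v := level_weight _ _ => cO.
rewrite -natr1 => av.
have : D * (c%:R * v) <= D * OPT w s0 rho by rewrite ler_wpM2l.
lra.
Qed.

End Competitive.

Theorem theorem2 (R : realType) :
  exists c : nat -> R,
    (exists2 f : nat -> R, f =O_\oo (fun k : nat => k%:R ^+ 2 : R)
                         & forall k : nat, c k = expR (f k)) /\
    forall k : nat, (1 <= k)%N ->
    forall (M : 'I_k -> eqType) (w : 'I_k -> R),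
      (forall l : 'I_k, 0 <= w l) ->
      (forall i j : 'I_k, (i <= j)%N -> w i <= w j) ->
    forall s0 : config M,
    exists A : @randomized_algorithm R k M s0, competitive w A (c k).
Proof.
pose f (k : nat) : R := 10 * k%:R ^+ 2.
exists (fun k => expR (f k)); split.
  exists f => //; apply/eqO_exP; exists 10 => //.
  by apply: nearW => k; rewrite /f normrM ger0_norm.
case=> // k _ M w w_ge0 w_le s0.
have [A [c' cA]] := competitive_alg s0 w_ge0 w_le.
exists A, c' => rho; apply: (le_trans (cA rho)); rewrite lee_fin lerD2r.
rewrite ler_wpM2r ?OPT_ge0 // (le_trans (phase_ratio_le _)) //.
(* The bases are compared through [2 = 1 + 1 <= expR 1]. *)
have -> : f k.+1 = (10 * k.+1 ^ 2)%:R * 1 by rewrite natrM natrX mulr1.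
rewrite expRM_natl.
rewrite lerXn2r ?nnegrE ?expR_ge0 // (le_trans _ (expR_ge1Dx _)) //.
Qed.
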